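(* Let $N\ge1$ and $1\le E\le D$ be integers. Let $[A]_{D+E}=[A]_D+[\Delta A]_E\,t^D$ with $[A]_D=\sum_{d=0}^{D-1}A_dt^d$, $[\Delta A]_E=\sum_{d=0}^{E-1}A_{D+d}t^d$, where all $A_d\in\mathbb R^{N\times N}$ are symmetric and $A_0$ has $N$ distinct eigenvalues. Let $[Q]_D=\sum_{d=0}^{D-1}Q_dt^d$ and $[\Lambda]_D=\sum_{d=0}^{D-1}\Lambda_dt^d$ with $Q_d,\Lambda_d\in\mathbb R^{N\times N}$ satisfy $$[Q]_D^T[A]_D[Q]_D\stackrel{D}{=}[\Lambda]_D,\qquad [Q]_D^T[Q]_D\stackrel{D}{=}I,\qquad [\Lambda]_D\text{ diagonal}.$$ Define successively: 1. $[\Delta F]_E$ and $[\Delta G]_E$ by $[\Delta F]_E\,t^D\stackrel{D+E}{=}[Q]_D^T[A]_D[Q]_D-[\Lambda]_D$ and $[\Delta G]_E\,t^D\stackrel{D+E}{=}[Q]_D^T[Q]_D-I$; 2. $[S]_E\stackrel{E}{=}-\tfrac12[\Delta G]_E$; 3. $[K]_E\stackrel{E}{=}[\Delta F]_E+[Q]_E^T[\Delta A]_E[Q]_E+[S]_E[\Lambda]_E+[\Lambda]_E[S]_E$; 4. $[\Delta\Lambda]_E\stackrel{E}{=}I\circ[K]_E$; 5. $[H_{ij}]_E\stackrel{E}{=}([\lambda_j]_E-[\lambda_i]_E)^{-1}$ if $i\ne j$ and $[H_{ij}]_E=0$ if $i=j$, where $[\lambda_i]_E$ is the $i$-th diagonal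 entry of $[\Lambda]_E$; 6. $[\Delta Q]_E\stackrel{E}{=}[Q]_E\big([H]_E\circ([K]_E-[\Delta\Lambda]_E)+[S]_E\big)$. Then $[Q]_{D+E}:=[Q]_D+[\Delta Q]_E\,t^D$ and $[\Lambda]_{D+E}:=[\Lambda]_D+[\Delta\Lambda]_E\,t^D$ satisfy $$[Q]_{D+E}^T[A]_{D+E}[Q]_{D+E}\stackrel{D+E}{=}[\Lambda]_{D+E},\qquad [Q]_{D+E}^T[Q]_{D+E}\stackrel{D+E}{=}I,\qquad [\Lambda]_{D+E}\text{ diagonal}.$$
   Context: For polynomials (or power series) in $t$ with matrix coefficients, $\stackrel{D}{=}$ means equality of the coefficients of $t^0,\dots,t^{D-1}$, i.e. equality modulo $t^D$. $[X]_D$ denotes a matrix polynomial of degree at most $D-1$ in $t$ with real matrix coefficients, representing an element modulo $t^D$. For $E\le D$, $[X]_E$ denotes the truncation of $[X]_D$ modulo $t^E$. Inverses of scalar polynomials in Step 5 are taken modulo $t^E$. The transpose acts coefficientwise. $\circ$ is the Hadamard (entrywise) product, with entries multiplied modulo $t^E$, so $I\circ K$ is the diagonal part of $K$. $I$ is the $N\times N$ identity matrix. A matrix polynomial is diagonal if all its coefficients are diagonal. *)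

(* Defs.v *)
From HB Require Import structures.
From mathcomp Require Import all_boot all_order all_algebra.
From mathcomp Require Import reals.

Set Implicit Arguments.
Unset Strict Implicit.
Unset Printing Implicit Defensive.

Import Order.TTheory GRing.Theory Num.Theory.
Local Open Scope ring_scope.

(* Matrix polynomials in t are elements of {poly 'M[R]_n.+1}, with 'X for t;
   the product is the noncommutative one, in which 'X is central. *)

Definition eqmodt (A : nzRingType) (D : nat) (P Q : {poly A}) : Prop :=
  forall d : nat, (d < D)%N -> P`_d = Q`_d.

Notation "P = Q %[modt D ]" := (eqmodt D P Q)
  (at level 70, Q at next level, format "P  =  Q  %[modt  D ]") : ring_scope.

Section MatrixPolynomials.

Variables (R : realType) (n : nat).
Implicit Types P Q : {poly 'M[R]_n.+1}.

Definition trmxp P : {poly 'M[R]_n.+1} := map_poly trmx P.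

Definition entryp (i j : 'I_n.+1) P : {poly R} :=
  map_poly (fun M : 'M[R]_n.+1 => M i j) P.

(* Entries are multiplied as polynomials in t and truncated modulo t^E; this
   is not the coefficientwise Hadamard product. *)
Definition hadamardp (E : nat) P Q : {poly 'M[R]_n.+1} :=
  \poly_(d < E) \matrix_(i, j) (entryp i j P * entryp i j Q)`_d.

Definition diagp P : Prop := forall d : nat, is_diag_mx P`_d.

Definition distinct_eigenvalues (M : 'M[R]_n.+1) : Prop :=
  exists s : seq R, [/\ uniq s, size s = n.+1 & s =i eigenvalue M].

(* The list of quantities computed from [A]_D, [Delta A]_E, [Q]_D, [Lambda]_D.
   Each is a polynomial of degree at most E - 1 pinned down by its defining
   congruence. *)
Record update_steps (D E : nat) (AD DA QD LD : {poly 'M[R]_n.+1})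
    (DF DG S K DL H DQ : {poly 'M[R]_n.+1}) : Prop := UpdateSteps {
  size_DF : (size DF <= E)%N;
  size_DG : (size DG <= E)%N;
  size_S : (size S <= E)%N;
  size_K : (size K <= E)%N;
  size_DL : (size DL <= E)%N;
  size_H : (size H <= E)%N;
  size_DQ : (size DQ <= E)%N;
  step_DF : DF * 'X^D = trmxp QD * AD * QD - LD %[modt D + E];
  step_DG : DG * 'X^D = trmxp QD * QD - 1 %[modt D + E];
  (* scalars act on matrix polynomials as scalar matrices *)
  step_S : S = (- 2^-1)%:M *: DG %[modt E];
  step_K : K = DF + trmxp (take_poly E QD) * DA * take_poly E QD
             + S * take_poly E LD + take_poly E LD * S %[modt E];
  step_DL : DL = hadamardp E 1 K %[modt E];
  step_H_offdiag : forall i j : 'I_n.+1, i != j ->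
    entryp i j H * (entryp j j (take_poly E LD) - entryp i i (take_poly E LD))
      = 1 %[modt E];
  step_H_diag : forall i : 'I_n.+1, entryp i i H = 0 %[modt E];
  step_DQ : DQ = take_poly E QD * (hadamardp E H (K - DL) + S) %[modt E]
}.

End MatrixPolynomials.

(* Main.v *)
Require Import Defs.
From HB Require Import structures.
From mathcomp Require Import all_boot all_order all_algebra.
From mathcomp Require Import reals.
From Stdlib Require Import Setoid Morphisms.

Set Implicit Arguments.
Unset Strict Implicit.
Unset Printing Implicit Defensive.

Import Order.TTheory GRing.Theory Num.Theory.
Local Open Scope ring_scope.

(** Put [U = W + S] with [W = H o (K - Delta Lambda)], so that
    [Delta Q = Q U]. Since [D >= E], the terms in [t^(2D)] vanish, and the
    coefficient of [t^D] in [Q^T Q - I] becomes [Delta G + U^T + U], that in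
    [Q^T A Q - Lambda] becomes
    [Delta F + Q^T (Delta A) Q + U^T Lambda + Lambda U].
    As [S] is symmetric and [W] antisymmetric, the former is
    [Delta G + 2 S = 0] and the latter is [K + Lambda W - W Lambda], where
    [H] is chosen so that the commutator equals [Delta Lambda - K].
    The inverses defining [H] exist because the diagonal of [Lambda_0] lists
    the distinct eigenvalues of [A_0]. *)

(** * Congruence modulo [t^D] and its compatibility with the ring operations *)

Section Congruence.

Variable A : nzRingType.
Implicit Types P Q : {poly A}.

#[global] Instance eqmodt_equivalence D : Equivalence (@eqmodt A D).
Proof.
split=> [P d _ | P Q PQ d dD | P Q S PQ QS d dD] //; first by rewrite PQ.
by rewrite PQ // QS.
Qed.

#[global] Instance eqmodt_add D :
  Proper (@eqmodt A D ==> @eqmodt A D ==> @eqmodt A D) +%R.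
Proof. by move=> P P' eqP Q Q' eqQ d dD; rewrite !coefD eqP ?eqQ. Qed.

#[global] Instance eqmodt_opp D : Proper (@eqmodt A D ==> @eqmodt A D) -%R.
Proof. by move=> P P' eqP d dD; rewrite !coefN eqP. Qed.

#[global] Instance eqmodt_mul D :
  Proper (@eqmodt A D ==> @eqmodt A D ==> @eqmodt A D) *%R.
Proof.
move=> P P' eqP Q Q' eqQ d dD; rewrite !coefM; apply: eq_bigr => i _.
rewrite eqP ?eqQ //; first exact: leq_ltn_trans (leq_subr _ _) dD.
exact: leq_ltn_trans (leq_ord i) dD.
Qed.

Lemma eqmodt_leq D E P Q : (E <= D)%N -> P = Q %[modt D] -> P = Q %[modt E].
Proof. by move=> ED PQ d dE; apply/PQ/(leq_trans dE). Qed.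

Lemma eqmodt_take D P : take_poly D P = P %[modt D].
Proof. by move=> d dD; rewrite coef_take_poly dD. Qed.

(** Multiplication by [t^D] only shifts coefficients; this reduces identities modulo [t^(D+E)] to
    identities between corrections modulo [t^E]. *)
Lemma eqmodt_mulXn D E P Q :
  P * 'X^D = Q * 'X^D %[modt D + E] <-> P = Q %[modt E].
Proof.
split=> PQ d dE.
  have := PQ (D + d)%N; rewrite ltn_add2l !coefMXn => /(_ dE).
  by rewrite ltnNge leq_addr addKn.
rewrite !coefMXn; case: ltnP => // Dd; apply: PQ.
by rewrite ltn_subLR.
Qed.

Lemma eqmodt_drop D E P : P = 0 %[modt D] ->
  (\poly_(d < E) P`_(D + d)) * 'X^D = P %[modt D + E].
Proof.
move=> P0 d dE; rewrite coefMXn; case: ltnP => dD; first by rewrite P0 ?coef0.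
by rewrite coef_poly ltn_subLR // dE subnKC.
Qed.

(** Since [t] is central, the only omitted term is [P1 * Q1] times [t^(2D)], and [D + E <= 2D]. *)
Lemma eqmodt_mulDXn D E (P0 P1 Q0 Q1 : {poly A}) : (E <= D)%N ->
  (P0 + P1 * 'X^D) * (Q0 + Q1 * 'X^D)
    = P0 * Q0 + (P0 * Q1 + P1 * Q0) * 'X^D %[modt D + E].
Proof.
move=> ED; have -> : (P0 + P1 * 'X^D) * (Q0 + Q1 * 'X^D)
    = P0 * Q0 + (P0 * Q1 + P1 * Q0) * 'X^D + P1 * Q1 * 'X^(D + D).
  rewrite mulrDl !mulrDr mulrDl !mulrA -!(mulrA P1) -!commr_polyXn.
  by rewrite -(mulrA Q1) -exprD !mulrA -!addrA.
move=> d dE; rewrite coefD [X in _ + X]coefMXn.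
by rewrite (leq_trans dE) ?addr0 // leq_add2l.
Qed.

End Congruence.

(** A nonzero constant term makes [p] coprime to [t^E]; the Bezout coefficient of [p] is the
    inverse. *)
Lemma eqmodt_inv_exists (F : fieldType) (E : nat) (p : {poly F}) :
  p`_0 != 0 -> exists q : {poly F}, q * p = 1 %[modt E].
Proof.
move=> p0; have /Bezout_eq1_coprimepP[[u v] /= uv] : coprimep p 'X^E.
  by rewrite coprimep_expr // coprimepX rootE horner_coef0.
exists u => d dE; rewrite -uv coefD [X in _ = _ + X]coefMXn dE addr0 //.
Qed.

(** * Transposes, entries and diagonal matrix polynomials *)

Section MatrixPolynomials.

Variables (R : realType) (n : nat).
Implicit Types P Q : {poly 'M[R]_n.+1}.

Lemma coef_trmxp P d : (trmxp P)`_d = (P`_d)^T.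
Proof. by rewrite coef_map_id0 ?trmx0. Qed.

Lemma coef_entryp i j P d : (entryp i j P)`_d = P`_d i j.
Proof. by rewrite coef_map_id0 ?mxE. Qed.

Lemma trmxpD P Q : trmxp (P + Q) = trmxp P + trmxp Q.
Proof. by apply/polyP => d; rewrite !(coefD, coef_trmxp) linearD. Qed.

Lemma trmxpN P : trmxp (- P) = - trmxp P.
Proof. by apply/polyP => d; rewrite !(coefN, coef_trmxp) linearN. Qed.

Lemma trmxp1 : trmxp (1 : {poly 'M[R]_n.+1}) = 1.
Proof.
by apply/polyP => d; rewrite coef_trmxp !coef1; case: eqP; rewrite ?trmx1 ?trmx0.
Qed.

Lemma trmxpM P Q : trmxp (P * Q) = trmxp Q * trmxp P.
Proof.
apply/polyP => d; rewrite coef_trmxp coefM coefMr linear_sum /=.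
by apply: eq_bigr => i _; rewrite !coef_trmxp trmx_mul.
Qed.

Lemma trmxpMXn P d : trmxp (P * 'X^d) = trmxp P * 'X^d.
Proof.
apply/polyP => k; rewrite coef_trmxp !coefMXn coef_trmxp.
by case: ifP; rewrite ?trmx0.
Qed.

Lemma trmxpK : involutive (@trmxp R n).
Proof. by move=> P; apply/polyP => d; rewrite !coef_trmxp trmxK. Qed.

#[global] Instance eqmodt_trmxp D :
  Proper (@eqmodt _ D ==> @eqmodt _ D) (@trmxp R n).
Proof. by move=> P Q PQ d dD; rewrite !coef_trmxp PQ. Qed.

#[global] Instance eqmodt_entryp D i j :
  Proper (@eqmodt _ D ==> @eqmodt _ D) (@entryp R n i j).
Proof. by move=> P Q PQ d dD; rewrite !coef_entryp PQ. Qed.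

(* Setoid rewriting loses track of the canonical ring structures on
   {poly 'M[R]_n.+1}; applying the congruence lemmas does not. *)
Ltac eqmodt_congr h :=
  solve [repeat first [ exact: h | apply: eqmodt_add | apply: eqmodt_opp
                      | apply: eqmodt_mul | apply: eqmodt_trmxp
                      | apply: eqmodt_entryp | reflexivity ]].

Ltac rewrite_modt h :=
  etransitivity; [eqmodt_congr h | symmetry];
  etransitivity; [eqmodt_congr h | symmetry].

Lemma eqmodt_entrypP D P Q :
  (forall i j, entryp i j P = entryp i j Q %[modt D]) -> P = Q %[modt D].
Proof.
move=> PQ d dD; apply/matrixP => i j.
by have := PQ i j d dD; rewrite !coef_entryp.
Qed.

Lemma entrypD i j P Q : entryp i j (P + Q) = entryp i j P + entryp i j Q.
Proof. by apply/polyP => d; rewrite !(coefD, coef_entryp) mxE. Qed.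

Lemma entrypN i j P : entryp i j (- P) = - entryp i j P.
Proof. by apply/polyP => d; rewrite !(coefN, coef_entryp) mxE. Qed.

Lemma entryp1 i j :
  entryp i j (1 : {poly 'M[R]_n.+1}) = (i == j)%:R :> {poly R}.
Proof.
apply/polyP => d; rewrite coef_entryp coef1 -polyC_natr coefC.
by case: d => [|d]; rewrite mxE.
Qed.

Lemma entrypM i j P Q :
  entryp i j (P * Q) = \sum_k entryp i k P * entryp k j Q.
Proof.
apply/polyP => d; rewrite coef_entryp coefM coef_sum summxE.
under [RHS]eq_bigr => k _ do rewrite coefM.
rewrite exchange_big /=; apply: eq_bigr => l _.
by rewrite mxE; apply: eq_bigr => k _; rewrite !coef_entryp.
Qed.

Lemma entryp_tr i j P : entryp i j (trmxp P) = entryp j i P.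
Proof. by apply/polyP => d; rewrite !coef_entryp coef_trmxp mxE. Qed.

Lemma entryp_hadamardp E i j P Q :
  entryp i j (hadamardp E P Q) = entryp i j P * entryp i j Q %[modt E].
Proof. by move=> d dE; rewrite coef_entryp coef_poly dE mxE. Qed.

Lemma diagp_tr P : diagp P -> trmxp P = P.
Proof.
move=> dP; apply/polyP => d; rewrite coef_trmxp.
by have /diag_mxP[v ->] := dP d; rewrite tr_diag_mx.
Qed.

Lemma diagp_entryp P i j : diagp P -> i != j -> entryp i j P = 0.
Proof.
move=> dP ij; apply/polyP => d; rewrite coef_entryp coef0.
by have /is_diag_mxP -> := dP d.
Qed.

Lemma entryp_diagM i j P Q : diagp P ->
  entryp i j (P * Q) = entryp i i P * entryp i j Q.
Proof.
move=> dP; rewrite entrypM (bigD1 i) //= big1 ?addr0 // => k ki.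
by rewrite (diagp_entryp dP) ?mul0r // eq_sym.
Qed.

Lemma entryp_Mdiag i j P Q : diagp Q ->
  entryp i j (P * Q) = entryp i j P * entryp j j Q.
Proof.
move=> dQ; rewrite entrypM (bigD1 j) //= big1 ?addr0 // => k ki.
by rewrite (diagp_entryp dQ) ?mulr0.
Qed.

(** A row eigenvector [v] of [M] for [a] gives a nonzero row [v *m V] with
    [v *m V *m L = a *: (v *m V)]; as [L] is diagonal, any nonzero entry [i] of that row forces
    [L i i = a]. So every eigenvalue occurs on the diagonal of [L]. *)
Lemma distinct_eigenvalues_diag (M V L : 'M[R]_n.+1) :
  distinct_eigenvalues M -> V^T *m V = 1%:M -> V^T *m M *m V = L ->
  is_diag_mx L -> injective (fun i => L i i).
Proof.
move=> [s [us ss es]] VV VMV dL.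
have sub : {subset s <= [seq L i i | i <- enum 'I_n.+1]}.
  move=> a; rewrite es => /eigenvalueP[v vM v0].
  have wL : v *m V *m L = a *: (v *m V).
    by rewrite -VMV !mulmxA -(mulmxA v V) (mulmx1C VV) mulmx1 vM scalemxAl.
  have : v *m V != 0.
    apply: contraNneq v0 => w0.
    by rewrite -[v]mulmx1 -(mulmx1C VV) mulmxA w0 mul0mx.
  move: (v *m V) wL => w wL /rV0Pn[i wi].
  have := congr1 (fun u : 'rV_n.+1 => u 0 i) wL; rewrite /= !mxE.
  rewrite (bigD1 i) //= big1 ?addr0 => [|j ji]; last first.
    by have /is_diag_mxP -> := dL; rewrite ?mulr0.
  rewrite mulrC => aw; apply/mapP; exists i; first by rewrite mem_enum.
  exact/esym/(mulIf wi).
(* A list of [n.+1] diagonal entries that contains [n.+1] distinct values has no repetition. *)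
apply/injectiveP; apply: (leq_size_uniq us sub).
by rewrite size_map size_enum_ord ss.
Qed.

(** This is the product rule for a triple product: only terms of first order in the corrections
    survive. *)
Lemma eqmodt_update D E (Q B Q' B' : {poly 'M[R]_n.+1}) : (E <= D)%N ->
  trmxp (Q + Q' * 'X^D) * (B + B' * 'X^D) * (Q + Q' * 'X^D)
    = trmxp Q * B * Q
      + (trmxp Q * B' * Q + (trmxp Q' * B * Q + trmxp Q * B * Q')) * 'X^D
    %[modt D + E].
Proof.
move=> ED; rewrite trmxpD trmxpMXn.
etransitivity.
  by apply: eqmodt_mul; [apply: eqmodt_mulDXn | reflexivity].
etransitivity; first exact: eqmodt_mulDXn.
rewrite (_ : _ + (_ + _) = trmxp Q * B * Q' + (trmxp Q * B' + trmxp Q' * B) * Q) //.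
by rewrite mulrDl addrA addrC.
Qed.

(** * The Hadamard product with [H] as solution of the commutator equation *)

Section Hadamard.

Variables (E : nat) (L H M : {poly 'M[R]_n.+1}).
Hypothesis diagL : diagp L.
Hypothesis invH : forall i j, i != j ->
  entryp i j H * (entryp j j L - entryp i i L) = 1 %[modt E].
Hypothesis diagM0 : forall i, entryp i i M = 0 %[modt E].

Let W := hadamardp E H M.

(* Entrywise this is ([lambda_i - lambda_j] H_ij) M_ij = - M_ij. *)
Lemma hadamardp_commutator : L * W - W * L = - M %[modt E].
Proof.
apply: eqmodt_entrypP => i j.
rewrite entrypD !entrypN entryp_diagM // entryp_Mdiag // mulrC -mulrBr.
rewrite -opprB mulrN; apply: eqmodt_opp.
rewrite /W; setoid_rewrite entryp_hadamardp.
have [<-|ij] := eqVneq i j.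
  by setoid_rewrite (diagM0 i); rewrite mulr0 mul0r.
by rewrite mulrAC; setoid_rewrite (invH ij); rewrite mul1r.
Qed.

(** Off the diagonal, [H_ij] and [H_ji] invert opposite differences, hence are opposite, while [M]
    is symmetric; on the diagonal [M] vanishes. *)
Lemma hadamardp_antisym : trmxp M = M %[modt E] -> trmxp W = - W %[modt E].
Proof.
move=> symM; apply: eqmodt_entrypP => i j.
rewrite entryp_tr entrypN; rewrite /W; setoid_rewrite entryp_hadamardp.
have [<-|ij] := eqVneq i j.
  by setoid_rewrite (diagM0 i); rewrite !mulr0 oppr0.
rewrite -(entryp_tr i j M); setoid_rewrite symM; rewrite -mulNr.
apply: eqmodt_mul; last reflexivity.
have ji : j != i by rewrite eq_sym.
(* Uniqueness of inverses: expand [1] as [H_ij (lambda_j - lambda_i)], then let [H_ji] cancel the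
   difference up to sign. *)
rewrite -[entryp j i H]mulr1; setoid_rewrite <- (invH ij) at 1.
rewrite -(opprB (entryp i i L)) !mulrN mulrCA.
by setoid_rewrite (invH ji); rewrite mulr1.
Qed.

End Hadamard.

(** * Diagonal parts and existence of the update *)

Lemma diagp_hadamardp1 E P : diagp (hadamardp E 1 P).
Proof.
move=> d; apply/is_diag_mxP => i j ij.
rewrite coef_poly; case: ifP => _; rewrite mxE //.
by rewrite entryp1 -val_eqE (negPf ij) mul0r coef0.
Qed.

Lemma entryp_hadamardp1 E i P :
  entryp i i (hadamardp E 1 P) = entryp i i P %[modt E].
Proof.
have := @entryp_hadamardp E i i 1 P.
by rewrite entryp1 eqxx mul1r.
Qed.

Lemma diagp_eqmodt E P Q :
  (size P <= E)%N -> P = Q %[modt E] -> diagp Q -> diagp P.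
Proof.
move=> sP PQ dQ d; case: (ltnP d E) => [dE|Ed]; first by rewrite PQ.
by rewrite nth_default ?(leq_trans sP) // mx0_is_diag.
Qed.

(** Only the inverses in [H] need an argument: the constant term of [lambda_j - lambda_i] is nonzero
    by injectivity. The other quantities are truncations of their defining expressions. *)
Lemma update_steps_exist D E (AD DA QD LD : {poly 'M[R]_n.+1}) :
  trmxp QD * AD * QD = LD %[modt D] ->
  trmxp QD * QD = 1 %[modt D] ->
  injective (fun i => LD`_0 i i) ->
  exists DF DG S K DL H DQ : {poly 'M[R]_n.+1},
    update_steps D E AD DA QD LD DF DG S K DL H DQ.
Proof.
move=> QAQ QQ injL.
(* All inverses are chosen at once; [0] is a dummy value where the requirement is vacuous, that is
   for [E = 0] or [i = j]. *)
have /fin_all_exists[h invh] (ij : 'I_n.+1 * 'I_n.+1) : exists q : {poly R},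
    ij.1 != ij.2 ->
    q * (entryp ij.2 ij.2 (take_poly E LD) - entryp ij.1 ij.1 (take_poly E LD))
      = 1 %[modt E].
  case: ij => i j /=; case: (posnP E) => [->|E_gt0]; first by exists 0.
  case: (eqVneq i j) => [_|ij]; first by exists 0.
  have [|q qP] := @eqmodt_inv_exists _ E
    (entryp j j (take_poly E LD) - entryp i i (take_poly E LD)).
    rewrite coefB !coef_entryp coef_take_poly E_gt0 subr_eq0.
    by rewrite (inj_eq injL) eq_sym.
  by exists q.
pose H : {poly 'M[R]_n.+1} :=
  \poly_(d < E) \matrix_(i, j) (if i == j then 0 else (h (i, j))`_d).
have QAQ0 : trmxp QD * AD * QD - LD = 0 %[modt D].
  by move=> d dD; rewrite coefB QAQ // subrr coef0.
have QQ0 : trmxp QD * QD - 1 = 0 %[modt D].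
  by move=> d dD; rewrite coefB QQ // subrr coef0.
have HE i j : i != j -> entryp i j H = h (i, j) %[modt E].
  by move=> ij d dE; rewrite coef_entryp coef_poly dE mxE (negPf ij).
(* The residuals vanish below [t^D], so their next [E] coefficients determine them modulo
   [t^(D+E)]. *)
pose DF : {poly 'M[R]_n.+1} := \poly_(d < E) (trmxp QD * AD * QD - LD)`_(D + d).
pose DG : {poly 'M[R]_n.+1} := \poly_(d < E) (trmxp QD * QD - 1)`_(D + d).
pose S := take_poly E ((- 2^-1)%:M *: DG).
pose K := take_poly E (DF + trmxp (take_poly E QD) * DA * take_poly E QD
             + S * take_poly E LD + take_poly E LD * S).
pose DL := hadamardp E 1 K.
exists DF, DG, S, K, DL, H,
  (take_poly E (take_poly E QD * (hadamardp E H (K - DL) + S))).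
split; rewrite ?size_poly //; try exact: eqmodt_take; try reflexivity.
- exact: eqmodt_drop QAQ0.
- exact: eqmodt_drop QQ0.
- by move=> i j ij; rewrite_modt (HE i j ij); exact: (invh (i, j)).
- by move=> i d dE; rewrite coef_entryp coef_poly dE mxE eqxx coef0.
Qed.

(** * Correctness of the update *)

Lemma trmxp_poly E (B : nat -> 'M[R]_n.+1) :
  (forall d, (d < E)%N -> (B d)^T = B d) ->
  trmxp (\poly_(d < E) B d) = \poly_(d < E) B d.
Proof.
move=> symB; apply/polyP => d; rewrite coef_trmxp coef_poly.
by case: ifP => dE; rewrite ?symB ?trmx0.
Qed.

Lemma update_steps_correct D E (AD DA QD LD DF DG S K DL H DQ :
    {poly 'M[R]_n.+1}) :
  (E <= D)%N ->
  trmxp AD = AD -> trmxp DA = DA ->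
  trmxp QD * AD * QD = LD %[modt D] ->
  trmxp QD * QD = 1 %[modt D] ->
  diagp LD ->
  update_steps D E AD DA QD LD DF DG S K DL H DQ ->
  [/\ trmxp (QD + DQ * 'X^D) * (AD + DA * 'X^D) * (QD + DQ * 'X^D)
        = LD + DL * 'X^D %[modt D + E],
      trmxp (QD + DQ * 'X^D) * (QD + DQ * 'X^D) = 1 %[modt D + E] &
      diagp (LD + DL * 'X^D)].
Proof.
move=> ED symA symDA QAQ QQ dL.
case=> _ _ _ _ sDL _ _ hDF hDG hS hK hDL hH _ hDQ.
have dDL : diagp DL by apply: diagp_eqmodt sDL hDL (diagp_hadamardp1 _ _).
have QE := @eqmodt_take _ E QD; have LE := @eqmodt_take _ E LD.
have {}hK : K = DF + trmxp QD * DA * QD + S * LD + LD * S %[modt E].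
  by etransitivity; [exact: hK | rewrite_modt QE; rewrite_modt LE; reflexivity].
have {}hDQ : DQ = QD * (hadamardp E H (K - DL) + S) %[modt E].
  by etransitivity; [exact: hDQ | rewrite_modt QE; reflexivity].
have {}hH i j : i != j ->
    entryp i j H * (entryp j j LD - entryp i i LD) = 1 %[modt E].
  move=> ij; etransitivity; last exact: (hH i j ij); symmetry.
  by rewrite_modt LE.
(* After multiplication by [t^D], the symmetry of [DF] is that of the residual; likewise for
   [DG]. *)
have symDF : trmxp DF = DF %[modt E].
  apply/(eqmodt_mulXn D); rewrite -trmxpMXn; rewrite_modt hDF.
  by rewrite trmxpD !trmxpM trmxpN trmxpK symA (diagp_tr dL) mulrA.
have symDG : trmxp DG = DG %[modt E].
  apply/(eqmodt_mulXn D); rewrite -trmxpMXn; rewrite_modt hDG.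
  by rewrite trmxpD trmxpM trmxpN trmxpK trmxp1.
have hSd d : (d < E)%N -> S`_d = (- 2^-1) *: DG`_d.
  by move=> /(hS d) ->; rewrite coefZ -mulmxE mul_scalar_mx.
have symS : trmxp S = S %[modt E].
  move=> d dE; have := symDG d dE; rewrite !coef_trmxp => symDGd.
  by rewrite hSd // -{2}symDGd; apply/matrixP => i j; rewrite !mxE.
have SS : S + S = - DG %[modt E].
  move=> d dE; rewrite coefD coefN hSd // scaleNr.
  by rewrite -opprD -scalerDl -[2^-1]mul1r -splitr scale1r.
have symK : trmxp K = K %[modt E].
  rewrite_modt hK; rewrite !trmxpD !trmxpM trmxpK symDA (diagp_tr dL).
  rewrite_modt symDF; rewrite_modt symS.
  by rewrite mulrA addrAC.
have symM : trmxp (K - DL) = K - DL %[modt E].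
  by rewrite trmxpD trmxpN (diagp_tr dDL); rewrite_modt symK.
have diag0 i : entryp i i (K - DL) = 0 %[modt E].
  move=> d dE; have /(_ d dE) := @entryp_hadamardp1 E i K.
  rewrite entrypD entrypN coefB !coef_entryp (hDL d dE) => ->.
  by rewrite subrr coef0.
have comW := hadamardp_commutator dL hH diag0.
have antiW := hadamardp_antisym hH diag0 symM.
(* From here on, only the commutator identity and the antisymmetry of [W] matter. *)
move: (hadamardp E H (K - DL)) comW antiW hDQ => W comW antiW hDQ.
have QAQE := eqmodt_leq ED QAQ; have QQE := eqmodt_leq ED QQ.
have trDQ : trmxp DQ = (S - W) * trmxp QD %[modt E].
  rewrite_modt hDQ; rewrite trmxpM trmxpD; rewrite_modt antiW.
  by rewrite_modt symS; rewrite addrC.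
have swap (x a b c : {poly 'M[R]_n.+1}) : x + a + b + c = x + c + b + a.
  by rewrite addrAC [X in X + _]addrAC addrAC.
split.
- etransitivity; first exact: eqmodt_update.
  (* The old product equals [LD + DF * 'X^D] modulo [t^(D+E)], so it remains to compare the
     coefficients of ['X^D] modulo [t^E]. *)
  rewrite -[trmxp QD * AD * QD](subrK LD).
  symmetry in hDF; rewrite_modt hDF.
  rewrite [_ + LD]addrC -addrA -mulrDl; apply: eqmodt_add; first reflexivity.
  apply/eqmodt_mulXn; rewrite_modt trDQ; rewrite_modt hDQ.
  transitivity (DF + (trmxp QD * DA * QD + ((S - W) * (trmxp QD * AD * QD)
                 + trmxp QD * AD * QD * (W + S)))).
    by rewrite !mulrA.
  (* As [E <= D], [LD] may replace the old product; the terms in [S] then complete [K], and the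
     commutator turns [K] into [DL]. *)
  rewrite_modt QAQE; transitivity (K + (LD * W - W * LD)).
    by rewrite_modt hK; rewrite mulrBl mulrDr !addrA (swap _ (- (W * LD))).
  by rewrite_modt comW; rewrite opprB addrC subrK.
- rewrite trmxpD trmxpMXn; etransitivity; first exact: eqmodt_mulDXn.
  rewrite -[trmxp QD * QD](subrK 1).
  symmetry in hDG; rewrite_modt hDG.
  rewrite [_ + 1]addrC -addrA -mulrDl.
  transitivity (1 + 0 * 'X^D : {poly 'M[R]_n.+1}); last by rewrite mul0r addr0.
  apply: eqmodt_add; first reflexivity.
  apply/eqmodt_mulXn; rewrite_modt trDQ; rewrite_modt hDQ.
  (* With [QD] orthogonal modulo [t^E], [W] cancels and [S + S] removes [DG]. *)
  rewrite mulrA -[(S - W) * _ * QD]mulrA; rewrite_modt QQE.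
  rewrite mul1r mulr1 [W + S]addrC addrACA subrr addr0.
  by rewrite_modt SS; rewrite subrr.
- move=> d; rewrite coefD coefMXn; have /diag_mxP[u ->] := dL d.
  case: ifP => _; first by rewrite addr0 diag_mx_is_diag.
  have /diag_mxP[v ->] := dDL (d - D)%N.
  by rewrite -linearD diag_mx_is_diag.
Qed.

End MatrixPolynomials.

(** The steps are relations rather than functions, so the existence half ensures that the universal
    half is not vacuous. *)
Theorem mainTheorem3 (R : realType) (n D E : nat)
    (E_ge1 : (1 <= E)%N) (E_leD : (E <= D)%N)
    (A Q L : nat -> 'M[R]_n.+1)
    (A_sym : forall d : nat, (d < D + E)%N -> (A d)^T = A d)
    (A0_eig : distinct_eigenvalues (A 0%N)) :
  let AD := \poly_(d < D) A d in
  let DA := \poly_(d < E) A (D + d)%N in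
  let QD := \poly_(d < D) Q d in
  let LD := \poly_(d < D) L d in
  trmxp QD * AD * QD = LD %[modt D] ->
  trmxp QD * QD = 1 %[modt D] ->
  diagp LD ->
  (exists DF DG S K DL H DQ : {poly 'M[R]_n.+1},
      update_steps D E AD DA QD LD DF DG S K DL H DQ) /\
  (forall DF DG S K DL H DQ : {poly 'M[R]_n.+1},
      update_steps D E AD DA QD LD DF DG S K DL H DQ ->
      let ADE := AD + DA * 'X^D in
      let QDE := QD + DQ * 'X^D in
      let LDE := LD + DL * 'X^D in
      [/\ trmxp QDE * ADE * QDE = LDE %[modt D + E],
          trmxp QDE * QDE = 1 %[modt D + E] &
          diagp LDE]).
Proof.
move=> AD DA QD LD QAQ QQ dL; have D_gt0 : (0 < D)%N := leq_trans E_ge1 E_leD.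
have symAD : trmxp AD = AD.
  by apply: trmxp_poly => d dD; apply/A_sym/ltn_addr.
have symDA : trmxp DA = DA.
  by apply: trmxp_poly => d dE; rewrite A_sym ?ltn_add2l.
split; last by move=> DF DG S K DL H DQ; apply: update_steps_correct.
apply: update_steps_exist => //.
(* The constant terms of the hypotheses say that [Q 0] is orthogonal and diagonalizes [A 0]. *)
apply: (distinct_eigenvalues_diag (V := Q 0%N) A0_eig) (dL 0%N).
- have := QQ 0%N D_gt0; rewrite coefM big_ord1 coef_trmxp coef1 !coef_poly.
  by rewrite D_gt0.
- have := QAQ 0%N D_gt0; rewrite -mulrA !(coefM, big_ord1) coef_trmxp !coef_poly.
  by rewrite D_gt0 mulrA.
Qed.
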